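(* Let $(\mathcal{B},\mathcal{L},\theta,\mathcal{I}_\alpha)$ be a generalized Boolean dynamical system with associated inverse semigroup $S$, $E=E(S)$, and $\Gamma=\Gamma(\mathcal{B},\mathcal{L},\theta,\mathcal{I}_\alpha)$. The topology on $\Gamma$ with basis the sets $$Z_{s,e:e_1,\dots,e_n}=\{(\eta^{\mu\gamma},|\mu|-|\nu|,\xi^{\nu\gamma})\in\Gamma:\xi\in V_{e:e_1,\dots,e_n}\text{ and }H_{[\mu]\gamma}(\eta)=H_{[\nu]\gamma}(\xi)\},$$ where $s=(\mu,A,\nu)\in S$ and $e,e_1,\dots,e_n\in E$, is the same as the topology generated by the basic open sets $$\mathcal{V}(X,m,n,Y)=\{(\eta,m-n,\xi):(\eta,\xi)\in X\times Y\text{ and }\sigma^m(\eta)=\sigma^n(\xi)\},$$ where $X$ (resp. $Y$) is an open subset of $\mathrm{dom}(\sigma^m)$ (resp. $\mathrm{dom}(\sigma^n)$) for which $\sigma^m|_X$ (resp. $\sigma^n|_Y$) is injective.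
   Context: **Generalized Boolean dynamical systems.** A Boolean algebra $\mathcal{B}$ is a (not necessarily unital) relatively complemented distributive lattice with least element $\emptyset$ and operations $\cap,\cup,\setminus$; $A\subseteq B$ means $A\cap B=A$. An ideal is a non-empty subset closed under finite unions and under intersection with arbitrary elements of $\mathcal{B}$. An action is a map $\mathcal{B}\to\mathcal{B}$ preserving $\cap,\cup,\setminus$ and $\emptyset$. A generalized Boolean dynamical system $(\mathcal{B},\mathcal{L},\theta,\mathcal{I}_\alpha)$ consists of a Boolean algebra $\mathcal{B}$, a set $\mathcal{L}$, actions $\{\theta_\alpha\}_{\alpha\in\mathcal{L}}$ and ideals $\{\mathcal{I}_\alpha\}_{\alpha\in\mathcal{L}}$ with $\{A\in\mathcal{B}:A\subseteq\theta_\alpha(B)\text{ for some }B\in\mathcal{B}\}\subseteq\mathcal{I}_\alpha$ for all $\alpha\in\mathcal{L}$. **Words.** $\mathcal{L}^*$: finite words over $\mathcal{L}$ (including the empty word $\emptyset$); $\mathcal{L}^\infty$: infinite words; $|\alpha|$: length; $\alpha_{i,j}=\alpha_i\cdots\alpha_j$ (empty if $j<i$). For $\alpha=\alpha_1\cdots\alpha_n$: $\theta_\alpha=\theta_{\alpha_n}\circ\cdots\circ\theta_{\alpha_1}$, $\theta_\emptyset=\mathrm{Id}$; $\mathcal{I}_\alpha=\{A\in\mathcal{B}:A\subseteq\theta_{\alpha_2\cdots\alpha_n}(B)\text{ for some }B\in\mathcal{I}_{\alpha_1}\}$ for $n\ge1$, $\mathcal{I}_\emptyset=\mathcal{B}$.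 $\mathcal{W}^*=\{\alpha\in\mathcal{L}^*:\mathcal{I}_\alpha\neq\{\emptyset\}\}$, $\mathcal{W}^\infty=\{\alpha\in\mathcal{L}^\infty:\alpha_{1,n}\in\mathcal{W}^*\ \forall n\geq1\}$, $\mathcal{W}^{\leq\infty}=\mathcal{W}^*\cup\mathcal{W}^\infty$. **Inverse semigroup.** $S=\{(\alpha,A,\beta):\alpha,\beta\in\mathcal{L}^*,\ \emptyset\neq A\in\mathcal{I}_\alpha\cap\mathcal{I}_\beta\}\cup\{0\}$, with $0$ absorbing and $(\alpha,A,\beta)(\gamma,B,\delta)$ equal to $(\alpha,A\cap B,\delta)$ if $\beta=\gamma$; $(\alpha\gamma',\theta_{\gamma'}(A)\cap B,\delta)$ if $\gamma=\beta\gamma'$; $(\alpha,A\cap\theta_{\beta'}(B),\delta\beta')$ if $\beta=\gamma\beta'$ (interpreted as $0$ when the middle entry is $\emptyset$); $0$ otherwise. Its semilattice of idempotents is $E(S)=\{(\alpha,A,\alpha):\emptyset\neq A\in\mathcal{I}_\alpha\}\cup\{0\}$, ordered by $e\le f$ iff $ef=e$. **Tight filters.** A filter in a poset with least element is a non-empty, upward closed, downward directed subset not containing the least element. Each filter $\xi$ in $E(S)$ has an associated word $\alpha\in\mathcal{W}^{\leq\infty}$ (the longest first entry of elements of $\xi$, or, if lengths are unbounded, the infinite word of which all first entries are beginnings); write $\xi=\xi^\alpha$ and $\xi_n=\{A\in\mathcal{I}_{\alpha_{1,n}}:(\alpha_{1,n},A,\alpha_{1,n})\in\xi\}$; $\xi$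 is determined by $\alpha$ and $\{\xi_n\}_n$. A finite $Z\subseteq\{y:y\le x\}$ is a cover for $x\in E(S)$ if every $0\neq y\le x$ satisfies $yz\neq0$ for some $z\in Z$; $\xi$ is tight if $Z\cap\xi\neq\emptyset$ for each $x\in\xi$ and each finite cover $Z$ of $x$. $\mathsf{T}$ is the set of tight filters, with basis of open sets $V_{e:e_1,\dots,e_n}=\{\xi\in\mathsf{T}:e\in\xi,e_i\notin\xi\ \forall i\}$, $e,e_i\in E(S)$, $n\ge0$. **The maps $H$, $\sigma$ and the groupoid $\Gamma$.** For non-empty $\alpha\in\mathcal{L}^*$ and $\alpha\gamma\in\mathcal{W}^{\le\infty}$, $H_{[\alpha]\gamma}$ sends a tight filter $\xi$ with word $\alpha\gamma$ to the (tight) filter $\eta$ with word $\gamma$ and $\eta_n=\{B\in\mathcal{I}_{\gamma_{1,n}}:A\subseteq B\text{ for some }A\in\xi_{|\alpha|+n}\}$, $0\le n\le|\gamma|$; $H_{[\emptyset]\gamma}$ is the identity. $\Gamma=\{(\eta^{\alpha\gamma},|\alpha|-|\beta|,\xi^{\beta\gamma})\in\mathsf{T}\times\mathbb{Z}\times\mathsf{T}:H_{[\alpha]\gamma}(\eta^{\alpha\gamma})=H_{[\beta]\gamma}(\xi^{\beta\gamma})\}$. The map $\sigma$, defined on $\{\xi^\alpha\in\mathsf{T}:|\alpha|\ge1\}$, is $\sigma(\xi^\alpha)=H_{[\alpha_1]\gamma}(\xi^\alpha)$ for $\alpha=\alpha_1\gamma$, $\alpha_1\in\mathcal{L}$; $\mathrm{dom}(\sigma^n)=\{\xi^\alpha\in\mathsf{T}:|\alpha|\ge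 n\}$, $\sigma^0=\mathrm{Id}_{\mathsf{T}}$. *)

(* Defs.v *)
From mathcomp Require Import all_boot all_order all_algebra.
From mathcomp Require Import boolp classical_sets.

Set Implicit Arguments.
Unset Strict Implicit.
Unset Printing Implicit Defensive.

Local Open Scope classical_set_scope.

Definition is_basis_on T (X : set T) (Bs : set (set T)) : Prop :=
  [/\ forall U, Bs U -> U `<=` X,
      X `<=` \bigcup_(U in Bs) U
    & forall U V x, Bs U -> Bs V -> U x -> V x ->
        exists2 W, Bs W & W x /\ W `<=` U `&` V].

Definition opens_of_basis T (Bs : set (set T)) : set (set T) :=
  [set U | exists2 F : set (set T), F `<=` Bs & U = \bigcup_(A in F) A].

(* A possibly non-unital Boolean algebra is a [cbDistrLatticeType]: a
   distributive lattice with bottom and relative complements, in which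
   [(A <= B)%O] amounts to [(A `&` B)%O = A] by [leEmeet]. *)

Definition is_action d (B : cbDistrLatticeType d) (f : B -> B) : Prop :=
  [/\ {morph f : A C / (A `&` C)%O}, {morph f : A C / (A `|` C)%O},
      {morph f : A C / (A `\` C)%O} & f \bot%O = \bot%O].

Definition is_ideal d (B : cbDistrLatticeType d) (I : set B) : Prop :=
  [/\ I !=set0, forall A C, I A -> I C -> I (A `|` C)%O
    & forall A C, I A -> I (A `&` C)%O].

Record gbds d (B : cbDistrLatticeType d) (L : eqType) := GBDS {
  theta : L -> B -> B;
  ideal : L -> set B;
  theta_action : forall a, is_action (theta a);
  ideal_is_ideal : forall a, is_ideal (ideal a);
  theta_ideal : forall a,
    [set A | exists C, (A <= theta a C)%O] `<=` ideal a }.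

Inductive word (L : Type) := Fin of seq L | Inf of nat -> L.

Definition wlen_ge L (n : nat) (w : word L) : bool :=
  match w with Fin s => n <= size s | Inf _ => true end.

(* The beginning of length [n], intended for [wlen_ge n w]. *)
Definition wtake L (n : nat) (w : word L) : seq L :=
  match w with Fin s => take n s | Inf f => mkseq f n end.

Definition wcat L (s : seq L) (w : word L) : word L :=
  match w with
  | Fin t => Fin (s ++ t)
  | Inf f => Inf (fun i => nth (f (i - size s)) s i)
  end.

(* Raw elements of the inverse semigroup; [None] is its zero. *)
Notation triple B L := (option (seq L * B * seq L)).

Section Groupoid.
Context d (B : cbDistrLatticeType d) (L : eqType) (G : gbds B L).

Implicit Types (a b g : seq L) (A : B) (e : triple B L)
  (xi : set (triple B L)).

Definition theta_word a A : B := foldl (fun C x => theta G x C) A a.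

Definition ideal_word a : set B :=
  if a is x :: a' then
    [set A | exists2 C, ideal G x C & (A <= theta_word a' C)%O]
  else setT.

Definition in_S : set (triple B L) :=
  [set s | if s is Some (a, A, b) then
     [/\ A != \bot%O, ideal_word a A & ideal_word b A] else True].

Definition mk_triple a A b : triple B L :=
  if A == \bot%O then None else Some (a, A, b).

Definition Smul (s t : triple B L) : triple B L :=
  match s, t with
  | Some (alpha, A, beta), Some (gamma, C, delta) =>
    if beta == gamma then mk_triple alpha (A `&` C)%O delta
    else if prefix beta gamma then
      let gamma' := drop (size beta) gamma in
      mk_triple (alpha ++ gamma') (theta_word gamma' A `&` C)%O delta
    else if prefix gamma beta then
      let beta' := drop (size gamma) beta in
      mk_triple alpha (A `&` theta_word beta' C)%O (delta ++ beta')
    else None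
  | _, _ => None
  end.

Definition in_E : set (triple B L) :=
  [set s | if s is Some (a, A, b) then
     [/\ a = b, A != \bot%O & ideal_word a A] else True].

Definition Ele (e f : triple B L) : Prop := Smul e f = e.

Definition is_filter xi : Prop :=
  [/\ xi `<=` in_E /\ xi !=set0,
      forall e f, xi e -> in_E f -> Ele e f -> xi f,
      forall e f, xi e -> xi f -> exists2 h, xi h & Ele h e /\ Ele h f
    & ~ xi None].

Definition is_cover (Z : seq (triple B L)) (x : triple B L) : Prop :=
  (forall z, z \in Z -> in_E z /\ Ele z x) /\
  (forall y, in_E y -> y != None -> Ele y x ->
     exists2 z, z \in Z & Smul y z != None).

Definition tight : set (set (triple B L)) :=
  [set xi | is_filter xi /\
     forall x Z, xi x -> is_cover Z x -> exists2 z, z \in Z & xi z].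

Definition V_set e (es : seq (triple B L)) : set (set (triple B L)) :=
  [set xi | [/\ tight xi, xi e & forall f, f \in es -> ~ xi f]].

Definition V_basis : set (set (set (triple B L))) :=
  [set U | exists e es,
     [/\ in_E e, forall f, f \in es -> in_E f & U = V_set e es]].

Definition open_tight : set (set (set (triple B L))) :=
  opens_of_basis V_basis.

Definition has_word xi (w : word L) : Prop :=
  match w with
  | Fin a => (exists A, xi (Some (a, A, a))) /\
             (forall b A, xi (Some (b, A, b)) -> size b <= size a)
  | Inf f => (forall n, exists b A, xi (Some (b, A, b)) /\ n <= size b) /\
             (forall b A, xi (Some (b, A, b)) -> b = mkseq f (size b))
  end.

(* Every filter has exactly one word; the default value is only reached on
   sets that are not filters. *)
Definition assoc_word xi : word L :=
  if pselect (exists w, has_word xi w) is left h then sval (cid h)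
  else Fin [::].

Definition component (w : word L) n xi : set B :=
  [set A | ideal_word (wtake n w) A /\
           xi (Some (wtake n w, A, wtake n w))].

(* [Hmap a g] is meant for filters with word [wcat a g]; its value is the
   filter with word [g] and the prescribed components. *)
Definition Hmap a (g : word L) xi : set (triple B L) :=
  if a is [::] then xi else
  [set e | exists n C,
     [/\ wlen_ge n g, e = Some (wtake n g, C, wtake n g),
         ideal_word (wtake n g) C
       & exists2 A, component (wcat a g) (size a + n) xi A & (A <= C)%O]].

(* The value at a filter with empty word, outside of the domain, is
   irrelevant. *)
Definition sigma xi : set (triple B L) :=
  match assoc_word xi with
  | Fin [::] => xi
  | Fin (x :: s) => Hmap [:: x] (Fin s) xi
  | Inf f => Hmap [:: f 0] (Inf (fun i => f i.+1)) xi
  end.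

Definition dom_sigma n : set (set (triple B L)) :=
  [set xi | tight xi /\ wlen_ge n (assoc_word xi)].

Local Notation arrow :=
  (set (triple B L) * int * set (triple B L))%type.

Definition matched mu nu (p : arrow) : Prop :=
  exists g : word L,
    [/\ assoc_word p.1.1 = wcat mu g, assoc_word p.2 = wcat nu g,
        p.1.2 = ((size mu)%:Z - (size nu)%:Z)%R
      & Hmap mu g p.1.1 = Hmap nu g p.2].

Definition Gamma : set arrow :=
  [set p | [/\ tight p.1.1, tight p.2 & exists a b, matched a b p]].

(* For [s = (mu, A, nu)]; the set does not depend on [A]. *)
Definition Z_set mu nu e (es : seq (triple B L)) : set arrow :=
  [set p | [/\ Gamma p, V_set e es p.2 & matched mu nu p]].

Definition Z_family : set (set arrow) :=
  [set U | exists mu A nu e es,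
     [/\ in_S (Some (mu, A, nu)), in_E e, forall f, f \in es -> in_E f
       & U = Z_set mu nu e es]].

Definition VX_set (X : set (set (triple B L))) (m n : nat)
    (Y : set (set (triple B L))) : set arrow :=
  [set p | [/\ X p.1.1, Y p.2, p.1.2 = (m%:Z - n%:Z)%R
             & iter m sigma p.1.1 = iter n sigma p.2]].

Definition open_injective n (X : set (set (triple B L))) : Prop :=
  [/\ open_tight X, X `<=` dom_sigma n & {in X &, injective (iter n sigma)}].

Definition VX_family : set (set arrow) :=
  [set U | exists X m n Y,
     [/\ open_injective m X, open_injective n Y & U = VX_set X m n Y]].

End Groupoid.

(* Main.v *)
(* For a filter [xi] with word [wcat a w], [Hmap a w xi] equals [shift a xi],
   which does not mention [w]: it consists of the [(g, C, g)] such that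
   [(ag, A, ag)] is in [xi] for some [A <= C].  Hence [sigma^n] is [shift a]
   on the filters whose word begins with [a], where [n = |a|], and it is
   injective there, because any element of such a filter lies above one of
   the form [(ag, A, ag)].  A basic set [Z] around [(eta, k, xi)] thus contains
   some [V(X, m, n, Y)] with [X] a set of filters containing a fixed element
   whose word begins with [mu].  Conversely, the condition
   [shift mu eta = shift nu xi] makes [eta] depend continuously on [xi]: both
   [f \in eta] and [f \notin eta] follow from finitely many memberships and
   non-memberships for [xi]. *)
Require Import Defs.
From mathcomp Require Import all_boot all_order all_algebra.
From mathcomp Require Import boolp classical_sets zify.

Set Implicit Arguments.
Unset Strict Implicit.
Unset Printing Implicit Defensive.

Import Order.TTheory.
Local Open Scope classical_set_scope.

(** * Beginnings and concatenation of words *)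

Section Words.
Context (L : eqType).
Implicit Types (a b s t : seq L) (w : word L).

Definition begins a w : Prop := wlen_ge (size a) w /\ wtake (size a) w = a.

(** A finite word is its own longest beginning, whereas an infinite word has beginnings of every
    length, from which each letter can be read. *)
Lemma begins_inj w w' : (forall a, begins a w <-> begins a w') -> w = w'.
Proof.
have fin_inf s f : ~ forall a, begins a (Fin s) <-> begins a (Inf f).
  move=> h; have [_] := h (mkseq f (size s).+1).
  by rewrite /begins size_mkseq /= ltnn => -[].
have fin_le s t : (forall a, begins a (Fin s) <-> begins a (Fin t)) ->
    size s <= size t.
  by move=> h; case: (h s) => + _; rewrite /begins /= take_size => -[].
case: w w' => [s|f] [t|g] h.
- have st := fin_le _ _ h.
  have ts : size t <= size s by apply: fin_le => a; split=> /h.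
  have [] := h t; rewrite /begins /= take_size => _ [] // _.
  by rewrite take_oversize // => ->.
- by case: (fin_inf s g).
- by case: (fin_inf t f) => a; split=> /h.
congr Inf; apply/funext => n.
have [+ _] := h (mkseq f n.+1); rewrite /begins size_mkseq => -[] // _ e.
have := congr1 (fun u => nth (f 0) u n) e.
by rewrite !nth_mkseq.
Qed.

Lemma wlen_ge_cat a n w : wlen_ge (size a + n) (wcat a w) = wlen_ge n w.
Proof. by case: w => [s|f] //=; rewrite size_cat leq_add2l. Qed.

Lemma wtake_cat a n w : wtake (size a + n) (wcat a w) = a ++ wtake n w.
Proof.
case: w => [s|f] /=.
  by rewrite take_cat ltnNge leq_addr /= addKn.
case: a => [|x a]; first by apply: eq_mkseq => i; rewrite nth_nil subn0.
apply: (@eq_from_nth _ x) => [|i]; rewrite size_mkseq ?size_cat ?size_mkseq //.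
move=> lti; rewrite nth_mkseq // nth_cat; case: ltnP => lei.
  exact: set_nth_default.
by rewrite nth_default // nth_mkseq // ltn_subLR.
Qed.

Lemma begins_cat a b w : begins (a ++ b) (wcat a w) <-> begins b w.
Proof.
rewrite /begins size_cat wlen_ge_cat wtake_cat.
split=> -[-> e]; split=> //; last by rewrite e.
by move/eqP: e; rewrite eqseq_cat // eqxx => /eqP.
Qed.

Lemma begins_catl a b w : begins (a ++ b) w -> begins a w.
Proof.
case: w => [s|f]; rewrite /begins /= size_cat => -[].
  move=> les e; split; first exact: leq_trans (leq_addr _ _) les.
  by rewrite -[in RHS](take_size_cat b (erefl (size a))) -e take_takel ?leq_addr.
move=> _ e; split=> //.
rewrite -[in RHS](take_size_cat b (erefl (size a))) -e.
by rewrite /mkseq -map_take take_iota (minn_idPl (leq_addr _ _)).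
Qed.

Lemma begins_wcat a w : begins a (wcat a w).
Proof.
by rewrite -{1}[a]cats0; apply/begins_cat; split; case: w => // -[].
Qed.

Lemma begins_prefix a b w : begins a w -> begins b w -> size a <= size b ->
  exists g, b = a ++ g.
Proof.
move=> [_ aE] Bb les; exists (drop (size a) b).
have [_ tE] : begins (take (size a) b) w.
  by apply: (@begins_catl _ (drop (size a) b)); rewrite cat_take_drop.
by rewrite size_takel // aE in tE; rewrite [X in X ++ _]tE cat_take_drop.
Qed.

End Words.

Section Systems.
Context d (B : cbDistrLatticeType d) (L : eqType) (G : gbds B L).
Implicit Types (a b g : seq L) (A C D : B) (e f : triple B L)
  (xi eta : set (triple B L)).

Local Notation idem a A := (Some (a, A, a)).

(** * Actions and ideals along words *)

Lemma theta_wordI a A C :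
  theta_word G a (A `&` C)%O = (theta_word G a A `&` theta_word G a C)%O.
Proof.
elim: a A C => //= x a IH A C; rewrite /theta_word /= -IH.
by case: (theta_action G x) => ->.
Qed.

Lemma theta_word_le a A C :
  (A <= C)%O -> (theta_word G a A <= theta_word G a C)%O.
Proof. by rewrite !leEmeet -theta_wordI => /eqP ->. Qed.

Lemma theta_word0 a : theta_word G a \bot%O = \bot%O.
Proof.
elim: a => //= x a IH; rewrite /theta_word /=.
by case: (theta_action G x) => _ _ _ ->.
Qed.

Lemma theta_word_cat a b A :
  theta_word G (a ++ b) A = theta_word G b (theta_word G a A).
Proof. exact: foldl_cat. Qed.

Lemma theta_word_neq0 a A C :
  A != \bot%O -> (A <= theta_word G a C)%O -> C != \bot%O.
Proof.
move=> A0 leA; apply: contra_neq A0 => C0.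
by apply/eqP; rewrite -lex0 -(theta_word0 a) -C0.
Qed.

Lemma ideal_word_le a A C : ideal_word G a C -> (A <= C)%O -> ideal_word G a A.
Proof.
case: a => //= x a [D iD leC] leA; exists D => //; exact: le_trans leC.
Qed.

(** When both words are non-empty, the bound on [A] is the image, under the rest of [b], of an
    element in the range of [theta G y], where [y] is the first letter of [b]; [theta_ideal] places
    that element in [ideal G y]. *)
Lemma ideal_word_suffix a b A : ideal_word G (a ++ b) A -> ideal_word G b A.
Proof.
case: a => //= x a [C iC]; rewrite theta_word_cat.
case: b => //= y b leA; exists (theta G y (theta_word G a C)) => //.
by apply: (@theta_ideal _ _ _ G); exists (theta_word G a C).
Qed.

Lemma ideal_word_theta a b A :
  ideal_word G a A -> ideal_word G (a ++ b) (theta_word G b A).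
Proof.
case: a => [_|x a [C iC leA]] /=.
  case: b => //= y b; exists (theta G y A) => //.
  by apply: (@theta_ideal _ _ _ G); exists A.
by exists C => //; rewrite theta_word_cat theta_word_le.
Qed.

(* Fails for [a] empty, since [ideal G x] can be larger than the ideal
   generated by the range of [theta G x]. *)
Lemma ideal_word_factor a b A : a != [::] -> ideal_word G (a ++ b) A ->
  exists2 C, ideal_word G a C & (A <= theta_word G b C)%O.
Proof.
case: a => // x a _ /= [C iC]; rewrite theta_word_cat => leA.
by exists (theta_word G a C) => //; exists C.
Qed.

(** The meet of [C] with the element given by [ideal_word_factor] serves as [D]. For [a] empty the
    ideal is everything and [C] itself serves, so the exception to that lemma disappears. *)
Lemma ideal_word_interp a b A C :
  ideal_word G (a ++ b) A -> (A <= theta_word G b C)%O ->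
  exists D, [/\ ideal_word G a D, (D <= C)%O & (A <= theta_word G b D)%O].
Proof.
have [->|a0] := eqVneq a [::]; first by exists C.
move=> /(ideal_word_factor a0)[D iD leD] leC.
exists (D `&` C)%O; split; [|exact: leIr|by rewrite theta_wordI lexI leD].
by apply: ideal_word_le iD _; exact: leIl.
Qed.

(** * Order on idempotents, and filters *)

(** The case of equal words is absorbed into the first branch, where the dropped word is empty and
    acts as the identity. The two prefix tests may be exchanged because both hold only for equal
    words. *)
Lemma SmulE a A b C :
  Smul G (idem a A) (idem b C) =
    if prefix b a then mk_triple a (A `&` theta_word G (drop (size b) a) C)%O a
    else if prefix a b then
      mk_triple b (theta_word G (drop (size a) b) A `&` C)%O b
    else None.
Proof.
rewrite /=; have [->|ab] := eqVneq a b.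
  by rewrite prefix_refl drop_size.
case: ifP => [pab|nab].
  case: ifP => pba.
    case/negP: ab; move/prefixP: pab pba => [g ->] /size_prefix.
    rewrite size_cat -{2}[size a]addn0 leq_add2l leqn0 size_eq0 => /eqP ->.
    by rewrite cats0.
  by move/prefixP: pab => [g ->]; rewrite drop_size_cat.
by case: ifP => // /prefixP[g ->]; rewrite drop_size_cat.
Qed.

Lemma EleP a A b C : A != \bot%O ->
  Ele G (idem a A) (idem b C) <->
  exists2 g, a = b ++ g & (A <= theta_word G g C)%O.
Proof.
rewrite /Ele SmulE => A0; split.
  case: ifP => [/prefixP[g ->]|_].
    rewrite drop_size_cat // /mk_triple; case: ifP => // _ [] /eqP.
    by rewrite -leEmeet; exists g.
  (* The product now carries the word [a ++ g], so it equals the left factor only if [g] is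
     empty. *)
  case: ifP => // /prefixP[g ->]; rewrite drop_size_cat // /mk_triple.
  case: ifP => // _ [] e1 /eqP; rewrite {1}[(_ `&` C)%O]meetC.
  have: size g = 0.
    move/(congr1 size)/eqP: e1.
    by rewrite size_cat -{2}[size a]addn0 eqn_add2l => /eqP.
  move/size0nil => ->; rewrite /= -[X in X == _]meetC -leEmeet => leA.
  by exists [::]; rewrite ?cats0.
move=> [g -> leA]; rewrite prefix_prefix drop_size_cat // /mk_triple.
by move: leA A0; rewrite leEmeet => /eqP -> /negbTE ->.
Qed.

Lemma filter_elt xi e : is_filter G xi -> xi e ->
  exists a A, [/\ e = (idem a A), A != \bot%O & ideal_word G a A].
Proof.
move=> [[sub _] _ _ nN] xe; have := sub _ xe; move: xe.
by case: e => [[[a A] b] _ [ <- A0 iA]|//]; exists a, A.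
Qed.

Lemma filter_neq0 xi a A : is_filter G xi -> xi (idem a A) -> A != \bot%O.
Proof. by move=> F /(filter_elt F)[b [C [[_ ->]]]]. Qed.

Lemma filter_ideal xi a A : is_filter G xi -> xi (idem a A) -> ideal_word G a A.
Proof. by move=> F /(filter_elt F)[b [C [[-> ->]]]]. Qed.

Lemma filter_up xi a g A C : is_filter G xi -> xi (idem (a ++ g) A) ->
  ideal_word G a C -> (A <= theta_word G g C)%O -> xi (idem a C).
Proof.
move=> F xA iC leA; have A0 := filter_neq0 F xA.
case: F => _ up _ _; apply: (up _ _ xA).
  by split=> //; exact: theta_word_neq0 leA.
by apply/EleP => //; exists g.
Qed.

Lemma filter_upw xi a A C : is_filter G xi -> xi (idem a A) ->
  ideal_word G a C -> (A <= C)%O -> xi (idem a C).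
Proof. by move=> F xA; apply: (@filter_up _ _ [::] A); rewrite ?cats0. Qed.

Lemma filter_dir xi a A b C : is_filter G xi ->
  xi (idem a A) -> xi (idem b C) ->
  exists g h D, [/\ a ++ g = b ++ h, xi (idem (a ++ g) D),
    (D <= theta_word G g A)%O & (D <= theta_word G h C)%O].
Proof.
move=> F xA xC; have [_ _ dir _] := F.
have [e xe [leA leC]] := dir _ _ xA xC.
have [c [D [De D0 _]]] := filter_elt F xe; rewrite {}De in xe leA leC.
case/EleP: leA => // g cE leA; case/EleP: leC => // h cE' leC.
by exists g, h, D; rewrite -cE -cE'; split; rewrite ?cE -?cE.
Qed.

Lemma filter_Ele xi e f :
  is_filter G xi -> xi e -> in_E G f -> Ele G e f -> xi f.
Proof. by case=> _ up _ _; apply: up. Qed.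

(** * The word of a filter *)

(** Stands for [begins a (assoc_word xi)] without the choice made in [assoc_word]; [starts_begins]
    relates the two on filters. *)
Definition starts a xi : Prop := exists g A, xi (idem (a ++ g) A).

Lemma filter_starts_elt xi a : is_filter G xi -> starts a xi ->
  forall b A, xi (idem b A) ->
  exists g h D, [/\ a ++ g = b ++ h, xi (idem (a ++ g) D)
    & (D <= theta_word G h A)%O].
Proof.
move=> F [g0 [A0 xA0]] b A xA.
have [g [h [D [e xD _ leA]]]] := filter_dir F xA0 xA.
by exists (g0 ++ g), h, D; rewrite catA; split; rewrite // catA.
Qed.

(** By [filter_dir] the words occurring in [xi] are pairwise comparable. If their lengths are
    bounded, a longest one is the word; otherwise all words longer than [n] carry the same letter at
    position [n], and these letters form an infinite word. *)
Lemma has_word_ex xi : is_filter G xi -> exists w, has_word xi w.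
Proof.
move=> F; have [[_ [e0 xe0]] _ _ _] := F.
have [a0 [A0 [De0 _ _]]] := filter_elt F xe0; rewrite {}De0 in xe0.
have [[N bN]|unb] :=
    pselect (exists N, forall b A, xi (idem b A) -> size b <= N).
  pose P n := `[< exists a A, xi (idem a A) /\ size a = n >].
  have exP : exists n, P n by exists (size a0); apply/asboolP; exists a0, A0.
  have leP n : P n -> n <= N by move=> /asboolP[a [A [xA <-]]]; exact: bN xA.
  case: (ex_maxnP exP leP) => n /asboolP[a [A [xA <-]]] max_a.
  exists (Fin a); split; first by exists A.
  by move=> b C xC; apply: max_a; apply/asboolP; exists b, C.
have long n : exists b A, xi (idem b A) /\ n < size b.
  apply: contrapT => no; apply: unb; exists n => b A xA; rewrite leqNgt.
  by apply/negP => lt_nb; apply: no; exists b, A.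
(* No letter is at hand in advance, so the sought letter [x] doubles as the default of [nth]; this
   is harmless since [n < size b]. *)
have /choice[f fE] n :
    exists x, forall b A, xi (idem b A) -> n < size b -> nth x b n = x.
  have [c [C [xC ltc]]] := long n; have [x _] : exists x : L, True.
    by case: c ltc {xC} => // x; exists x.
  exists (nth x c n) => b A xA ltb.
  have [g [h [_ [e _ _ _]]]] := filter_dir F xC xA.
  have := congr1 (fun u => nth x u n) e.
  by rewrite !nth_cat ltc ltb => ->; exact: set_nth_default.
exists (Inf f); split=> [n|b A xA].
  by have [b [A [xA /ltnW]]] := long n; exists b, A.
apply: (@eq_from_nth _ (f 0)) => [|i ltib]; first by rewrite size_mkseq.
by rewrite nth_mkseq // -[RHS](fE _ _ _ xA ltib); exact: set_nth_default.
Qed.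

(** Holds for whichever word [cid] returns. If it is finite, an element of [xi] whose word extends
    both [a] and the longest word must carry the longest word itself. *)
Lemma starts_begins xi a : is_filter G xi ->
  starts a xi <-> begins a (assoc_word xi).
Proof.
move=> F; rewrite /assoc_word; case: pselect => [h|[]]; last exact: has_word_ex.
case: (cid h) => -[s|f] /= [].
  move=> [A xA] max_s; split.
    move=> Sa; have [g [k [D [e xD _]]]] := filter_starts_elt F Sa xA.
    have := max_s _ _ xD; rewrite e size_cat -{2}[size s]addn0 leq_add2l leqn0.
    rewrite size_eq0 => /eqP k0; rewrite k0 cats0 in e.
    by rewrite -e; split=> /=; rewrite ?size_cat ?leq_addr ?take_size_cat.
  move=> [_ /= e]; exists (drop (size a) s), A.
  by rewrite -[X in X ++ _]e cat_take_drop.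
move=> long xf; split.
  move=> [g [A /xf e]]; apply: (@begins_catl _ _ g); split=> //.
move=> [_ /= e]; have [b [A [xA ltb]]] := long (size a).
exists (drop (size a) b), A; rewrite -[X in X ++ _]e.
suff -> : mkseq f (size a) = take (size a) b by rewrite cat_take_drop.
by rewrite (xf _ _ xA) /mkseq -map_take take_iota (minn_idPl ltb).
Qed.

Lemma starts_catl xi a b : starts (a ++ b) xi -> starts a xi.
Proof. by move=> [g [A]]; rewrite -catA; exists (b ++ g), A. Qed.

(** * The shift of a filter, and its link with [Hmap] and [sigma] *)

Definition shift a xi : set (triple B L) :=
  [set e | exists g C, [/\ e = idem g C, ideal_word G g C
    & exists2 A, xi (idem (a ++ g) A) & (A <= C)%O]].

Lemma shiftP a xi g C : shift a xi (idem g C) <->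
  ideal_word G g C /\ exists2 A, xi (idem (a ++ g) A) & (A <= C)%O.
Proof.
by split=> [[h [D [[-> ->]]]]|[]] //; exists g, C.
Qed.

Lemma mem_shift a xi g A :
  is_filter G xi -> xi (idem (a ++ g) A) -> shift a xi (idem g A).
Proof.
move=> F xA; apply/shiftP; split; last by exists A.
exact: ideal_word_suffix (filter_ideal F xA).
Qed.

(** Membership in [shift a xi] places [A] only in [ideal_word G g], which can be larger than
    [ideal_word G (a ++ g)]; hence the hypothesis on [A]. *)
Lemma shift_mem a xi g A : is_filter G xi -> ideal_word G (a ++ g) A ->
  shift a xi (idem g A) -> xi (idem (a ++ g) A).
Proof. by move=> F iA /shiftP[_ [C xC leC]]; exact: filter_upw xC _ _. Qed.

Lemma shift0 xi : is_filter G xi -> shift [::] xi = xi.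
Proof.
move=> F; apply/seteqP; split=> e.
  by move=> [g [C [-> iC [A xA leA]]]]; exact: filter_upw xA _ _.
move=> xe; have [a [A [De _ iA]]] := filter_elt F xe; rewrite De in xe *.
by apply/shiftP; split=> //; exists A.
Qed.

Lemma shift_cat a b xi : is_filter G xi ->
  shift (a ++ b) xi = shift b (shift a xi).
Proof.
move=> F; apply/seteqP; split=> _ [g [C [-> iC [A xA leA]]]]; apply/shiftP.
  by split=> //; exists A => //; apply: mem_shift => //; rewrite catA.
move/shiftP: xA => [_ [D xD leD]]; split=> //; exists D; first by rewrite -catA.
exact: le_trans leA.
Qed.

Lemma starts_shift a b xi : is_filter G xi ->
  starts b (shift a xi) <-> starts (a ++ b) xi.
Proof.
move=> F; split=> [[g [C /shiftP[_ [A xA _]]]]|[g [A xA]]]; exists g, A.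
  by rewrite -catA.
by apply: mem_shift => //; rewrite catA.
Qed.

Lemma filter_shift a xi : is_filter G xi -> starts a xi ->
  is_filter G (shift a xi).
Proof.
move=> F [g0 [A0 xA0]]; split.
- split=> [e [g [C [-> iC [A xA leA]]]]|]; last first.
    by exists (idem g0 A0); exact: mem_shift.
  split=> //; apply: contra_neq (filter_neq0 F xA) => C0.
  by apply/eqP; rewrite -lex0 -C0.
- move=> e [[[b D] ?] Se [ <- D0 iD]|]; last first.
    by move=> Se _; rewrite /Ele => e0; case: Se => g [C [De]]; rewrite De in e0.
  case: Se => g [C [-> iC [A xA leA]]].
  have A1 := filter_neq0 F xA.
  have C0 : C != \bot%O.
    by apply: contra_neq A1 => C0; apply/eqP; rewrite -lex0 -C0.
  case/EleP => // h gE leC; rewrite {}gE catA in xA *.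
  (* [D] need not lie in the ideal of [a ++ b], so upward closure of [xi] is applied to an
     interpolated [D'] below it that does. *)
  have [D' [iD' leD' leAD']] :=
    ideal_word_interp (filter_ideal F xA) (le_trans leA leC).
  apply/shiftP; split=> //; exists D' => //; exact: filter_up xA _ _.
- move=> _ _ [g [C [-> iC [A xA leA]]]] [h [D [-> iD [A' xA' leA']]]].
  have [k [l [E [e xE leE leE']]]] := filter_dir F xA xA'.
  have E0 := filter_neq0 F xE.
  have e' : g ++ k = h ++ l.
    by move/eqP: e; rewrite -!catA eqseq_cat // eqxx => /eqP.
  exists (idem (g ++ k) E); first by apply: mem_shift => //; rewrite catA.
  split; apply/EleP => //.
    by exists k => //; apply: le_trans leE _; exact: theta_word_le.
  by exists l => //; apply: le_trans leE' _; exact: theta_word_le.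
- by move=> [g [C []]].
Qed.

Lemma shift_inj a xi eta : is_filter G xi -> is_filter G eta ->
  starts a xi -> starts a eta -> shift a xi = shift a eta -> xi = eta.
Proof.
have sub (xi' eta' : set (triple B L)) : is_filter G xi' -> is_filter G eta' ->
    starts a xi' -> shift a xi' `<=` shift a eta' -> xi' `<=` eta'.
  move=> F F' Sa le e xe.
  have [b [A [De _ iA]]] := filter_elt F xe; rewrite De in xe *.
  have [g [h [D [E xD leD]]]] := filter_starts_elt F Sa xe.
  apply: (@filter_up _ _ h D) => //; rewrite -E.
  apply: shift_mem => //; first exact: filter_ideal F xD.
  by apply: le; exact: mem_shift.
by move=> F F' Sx Se e; apply/seteqP; split; apply: sub => //; rewrite e.
Qed.

(** Once [a] is split off, the remaining word and the word of the shift have the same beginnings by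
    [starts_shift], so [begins_inj] applies. *)
Lemma assoc_word_shift a xi : is_filter G xi -> starts a xi ->
  assoc_word xi = wcat a (assoc_word (shift a xi)).
Proof.
move=> F Sa; have F' := filter_shift F Sa.
have Ba : begins a (assoc_word xi) by apply/starts_begins.
have [w E] : exists w, assoc_word xi = wcat a w.
  case: (assoc_word xi) Ba => [s|f] [_ /= e].
    by exists (Fin (drop (size a) s)); rewrite /= -{1}e cat_take_drop.
  exists (Inf (fun i => f (size a + i))); congr Inf; apply/funext => i.
  have [lti|lei] := ltnP i (size a); last by rewrite nth_default // subnKC.
  by rewrite -e nth_mkseq.
rewrite E; congr wcat; apply: begins_inj => b.
by rewrite -(begins_cat a) -E -!starts_begins // starts_shift.
Qed.

Lemma Hmap_shift a w xi : is_filter G xi -> assoc_word xi = wcat a w ->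
  Hmap G a w xi = shift a xi.
Proof.
move=> F xw; rewrite /Hmap; case: a xw => [|x a] xw; first by rewrite shift0.
move: xw; set b := x :: a => xw.
apply/seteqP; split=> [_ [n [C [len -> iC [A]]]]|_ [g [C [-> iC [A xA leA]]]]].
  rewrite /component wtake_cat => -[iA xA] leA.
  by apply/shiftP; split=> //; exists A.
(* An element of [xi] with word [b ++ g] makes [g] a beginning of [w], so the index asked for by
   [Hmap] is [size g]. *)
have /begins_cat[len wg] : begins (b ++ g) (wcat b w).
  by rewrite -xw -starts_begins //; exists [::], A; rewrite cats0.
exists (size g), C; rewrite wg; split=> //; exists A => //.
by rewrite /component wtake_cat wg; split=> //; exact: filter_ideal F xA.
Qed.

Lemma sigma_shift x xi : is_filter G xi -> starts [:: x] xi ->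
  sigma G xi = shift [:: x] xi.
Proof.
move=> F Sx; have E := assoc_word_shift F Sx; rewrite -(Hmap_shift F E).
rewrite /sigma E; case: (assoc_word (shift _ _)) => // f.
by congr (Hmap G _ (Inf _) _); apply/funext => i; rewrite /= nth_nil subn1.
Qed.

Lemma iter_sigma a xi : is_filter G xi -> starts a xi ->
  iter (size a) (sigma G) xi = shift a xi.
Proof.
(* [iter] puts the last [sigma] outermost, so the word grows at its right end. *)
move=> F; elim/last_ind: a => [|a x IH]; first by rewrite shift0.
rewrite size_rcons iterS -cats1 => Sax; have Sa := starts_catl Sax.
rewrite IH // (@sigma_shift x) ?shift_cat //; first exact: filter_shift.
exact/starts_shift.
Qed.

(** * Arrows matched by a pair of words *)

(** The tail shared by the two words in [matched] is recovered as the word of the common shift. *)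
Lemma matchedP mu nu p : is_filter G p.1.1 -> is_filter G p.2 ->
  matched G mu nu p <->
  [/\ starts mu p.1.1, starts nu p.2,
      p.1.2 = ((size mu)%:Z - (size nu)%:Z)%R & shift mu p.1.1 = shift nu p.2].
Proof.
move=> F F'; split=> [[w [Ew Ew' k]]|[Sm Sn k e]].
  rewrite !Hmap_shift // => e; split=> //; apply/starts_begins => //.
    by rewrite Ew; exact: begins_wcat.
  by rewrite Ew'; exact: begins_wcat.
exists (assoc_word (shift mu p.1.1)).
have Em := assoc_word_shift F Sm; have En := assoc_word_shift F' Sn.
by rewrite -e in En; split=> //; rewrite !Hmap_shift.
Qed.

(** By [shift_cat] the hypothesis equates two shifts by [g], and [shift_inj] cancels [g]. *)
Lemma matched_catl mu nu g p : is_filter G p.1.1 -> is_filter G p.2 ->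
  matched G (mu ++ g) (nu ++ g) p -> matched G mu nu p.
Proof.
move=> F F' /(matchedP _ _ F F')[Sm Sn k e].
have [Sm' Sn'] := (starts_catl Sm, starts_catl Sn).
apply/matchedP => //; split=> //.
  by rewrite k !size_cat; lia.
by apply: (@shift_inj g); rewrite -?shift_cat //;
  try exact: filter_shift; exact/starts_shift.
Qed.

(** The integer [p.1.2] makes [mu'] and [nu'] exceed [mu] and [nu] by the same length; both excess
    words begin the common tail [w], hence they coincide. *)
Lemma matched_comparable mu nu mu' nu' p :
  is_filter G p.1.1 -> is_filter G p.2 ->
  matched G mu nu p -> matched G mu' nu' p -> size mu <= size mu' ->
  exists2 g, mu' = mu ++ g & nu' = nu ++ g.
Proof.
move=> F F' [w [E1 E2 k _]] [w' [E1' E2' k' _]] les.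
have [g muE] : exists g, mu' = mu ++ g.
  apply: (begins_prefix (w := assoc_word p.1.1) _ _ les).
    by rewrite E1; exact: begins_wcat.
  by rewrite E1'; exact: begins_wcat.
have sE : size nu + size mu' = size mu + size nu'.
  by move: k; rewrite k'; lia.
have [h nuE] : exists h, nu' = nu ++ h.
  have lesn : size nu <= size nu' by move: sE les; lia.
  apply: (begins_prefix (w := assoc_word p.2) _ _ lesn).
    by rewrite E2; exact: begins_wcat.
  by rewrite E2'; exact: begins_wcat.
have Bg : begins g w.
  by apply/(begins_cat mu); rewrite -E1 -muE E1'; exact: begins_wcat.
have Bh : begins h w.
  by apply/(begins_cat nu); rewrite -E2 -nuE E2'; exact: begins_wcat.
have sgh : size g = size h.
  by move: sE; rewrite muE nuE !size_cat; lia.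
by exists g => //; rewrite nuE -(Bh.2) -sgh Bg.2.
Qed.

(** * Continuous dependence of the first filter of an arrow on the second *)

(** Only a neighbourhood of [xi] is wanted, so a lower bound of [e] and [e'] inside [xi] replaces
    their product. *)
Lemma V_set_meet xi e es e' es' : V_set G e es xi -> V_set G e' es' xi ->
  exists e'', [/\ in_E G e'', V_set G e'' (es ++ es') xi
    & V_set G e'' (es ++ es') `<=` V_set G e es `&` V_set G e' es'].
Proof.
move=> [T xe xes] [_ xe' xes']; have [F _] := T; have [[sub _] _ dir _] := F.
have [e'' xe'' [le le']] := dir _ _ xe xe'.
exists e''; split; first exact: sub.
  split=> // f; rewrite mem_cat => /orP[]; [exact: xes|exact: xes'].
move=> eta [Te ee'' nes]; have [Fe _] := Te.
split; split=> // [|f fin].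
- exact: filter_Ele ee'' (sub _ xe) le.
- by apply: nes; rewrite mem_cat fin.
- exact: filter_Ele ee'' (sub _ xe') le'.
- by apply: nes; rewrite mem_cat fin orbT.
Qed.

(** Equality of shifts at [p] produces [A]; equality of shifts at [q] carries it back, and
    [shift_mem] applies because [D] is already known to lie in the ideal of [mu ++ g]. *)
Lemma matched_pull mu nu p g D : is_filter G p.1.1 -> is_filter G p.2 ->
  matched G mu nu p -> p.1.1 (idem (mu ++ g) D) ->
  exists A, [/\ p.2 (idem (nu ++ g) A), (A <= D)%O
    & forall q, is_filter G q.1.1 -> is_filter G q.2 -> matched G mu nu q ->
      q.2 (idem (nu ++ g) A) -> q.1.1 (idem (mu ++ g) D)].
Proof.
move=> F F' /(matchedP _ _ F F')[_ _ _ e] pD.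
have iD := filter_ideal F pD.
have := mem_shift F pD; rewrite e => /shiftP[iD' [A pA leA]].
exists A; split=> // q Fq Fq' /(matchedP _ _ Fq Fq')[_ _ _ eq] qA.
by apply: shift_mem => //; rewrite eq; apply/shiftP; split=> //; exists A.
Qed.

(** [f] dominates an element of [p.1.1] whose word extends [mu], to which [matched_pull] applies. *)
Lemma matched_nbhd_pos mu nu p f : is_filter G p.1.1 -> is_filter G p.2 ->
  matched G mu nu p -> p.1.1 f ->
  exists2 e, p.2 e & forall q, is_filter G q.1.1 -> is_filter G q.2 ->
    matched G mu nu q -> q.2 e -> q.1.1 f.
Proof.
move=> F F' M pf; have [Sm _ _ _] := (matchedP mu nu F F').1 M.
have [b [C [Df _ iC]]] := filter_elt F pf; rewrite {}Df in pf *.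
have [g [h [D [E pD leD]]]] := filter_starts_elt F Sm pf.
have [A [pA leA qA]] := matched_pull F F' M pD.
exists (idem (nu ++ g) A) => // q Fq Fq' Mq /(qA _ Fq Fq' Mq); rewrite E => qD.
exact: filter_up qD _ _.
Qed.

Lemma mk_triple_in_E a A : ideal_word G a A -> in_E G (mk_triple a A a).
Proof. by rewrite /mk_triple; case: eqVneq. Qed.

(** The conclusion concerns the product of the triples with entries [D] and [A]. The factor
    [theta_word G g A] brings it into the ideal of [a ++ g], where [D] itself may fail to lie. *)
Lemma filter_meet xi a g A C D : is_filter G xi ->
  xi (idem a A) -> xi (idem (a ++ g) C) -> (C <= D)%O ->
  xi (mk_triple (a ++ g) (D `&` theta_word G g A)%O (a ++ g)).
Proof.
move=> F xA xC leCD; have [h [k [E [e xE leA leC]]]] := filter_dir F xA xC.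
have E0 := filter_neq0 F xE.
have hE : h = g ++ k by move/eqP: e; rewrite -catA eqseq_cat // eqxx => /eqP.
have leE : (E <= theta_word G k (D `&` theta_word G g A))%O.
  rewrite theta_wordI lexI -theta_word_cat -hE leA andbT.
  exact: le_trans leC (theta_word_le _ leCD).
rewrite /mk_triple (negbTE (theta_word_neq0 E0 leE)).
rewrite hE catA in xE; apply: filter_up xE _ leE => //.
apply: ideal_word_le (leIr _ _); apply: ideal_word_theta.
exact: filter_ideal F xA.
Qed.

Lemma filter_mk xi a A : is_filter G xi -> xi (mk_triple a A a) -> xi (idem a A).
Proof. by case=> _ _ _ nN; rewrite /mk_triple; case: ifP. Qed.

Lemma cat_eq_prefix a b g h : a ++ g = b ++ h -> prefix a b || prefix b a.
Proof.
move=> e; rewrite !prefixE; have [les|/ltnW les] := leqP (size a) (size b).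
  by rewrite -(takel_cat h les) -e take_size_cat ?eqxx.
by rewrite -(takel_cat g les) e take_size_cat ?eqxx ?orbT.
Qed.

(* After meeting [f] with an element [(mu g0, D0, mu g0)] of [eta], one may
   assume that its word extends [mu g0]; then [f \in eta] is equivalent, near
   [xi], to the membership in [xi] of a single idempotent. *)
Lemma matched_nbhd_neg mu nu p f : is_filter G p.1.1 -> is_filter G p.2 ->
  matched G mu nu p -> in_E G f -> ~ p.1.1 f ->
  exists e e', [/\ p.2 e, in_E G e', ~ p.2 e'
    & forall q, is_filter G q.1.1 -> is_filter G q.2 -> matched G mu nu q ->
      q.2 e -> ~ q.2 e' -> ~ q.1.1 f].
Proof.
move=> F F' M; have [[g0 [D0 pD0]] _ _ es] := (matchedP mu nu F F').1 M.
have [A0 [pA0 leA0 qA0]] := matched_pull F F' M pD0.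
have nN : ~ p.2 None by case: F'.
case: f => [[[b C] _] [ <- C0 iC] npf|_ _]; last first.
  by exists (idem (nu ++ g0) A0), None; split=> // q [].
exists (idem (nu ++ g0) A0); set c := mu ++ g0 in pD0 qA0.
(* The triple is moved from [c ++ h] to [n]. Since [C'] need not lie in the ideal of [n], it is
   first met with the image of [A0], which costs nothing as long as [A0] is present in [q.2]. *)
have key h C' : ideal_word G (c ++ h) C' -> ~ p.1.1 (idem (c ++ h) C') ->
    exists e', [/\ in_E G e', ~ p.2 e'
      & forall q, is_filter G q.1.1 -> is_filter G q.2 -> matched G mu nu q ->
        q.2 (idem (nu ++ g0) A0) -> ~ q.2 e' -> ~ q.1.1 (idem (c ++ h) C')].
  rewrite -catA => iC' npC'; set n := nu ++ g0 ++ h.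
  exists (mk_triple n (C' `&` theta_word G h A0)%O n); split.
  - apply: mk_triple_in_E; rewrite /n catA.
    apply: ideal_word_le (leIr _ _); apply: ideal_word_theta.
    exact: filter_ideal F' pA0.
  - move=> /(filter_mk F') pe; apply: npC'.
    apply: shift_mem => //; rewrite es; apply/shiftP; split.
      exact: ideal_word_suffix iC'.
    by exists (C' `&` theta_word G h A0)%O => //; exact: leIl.
  - move=> q Fq Fq' /(matchedP _ _ Fq Fq')[_ _ _ eq] qA nqe qC'; apply: nqe.
    have := mem_shift Fq qC'; rewrite eq => /shiftP[iC2 [A qA' leA]].
    by rewrite /n catA; apply: (@filter_meet _ _ _ _ A) => //; rewrite -catA.
have reduce e' : in_E G e' -> ~ p.2 e' ->
    (forall q, is_filter G q.1.1 -> is_filter G q.2 -> matched G mu nu q ->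
      q.2 (idem (nu ++ g0) A0) -> ~ q.2 e' -> ~ q.1.1 (idem b C)) ->
    exists e'0, [/\ p.2 (idem (nu ++ g0) A0), in_E G e'0, ~ p.2 e'0
    & forall q, is_filter G q.1.1 -> is_filter G q.2 -> matched G mu nu q ->
      q.2 (idem (nu ++ g0) A0) -> ~ q.2 e'0 -> ~ q.1.1 (idem b C)].
  by move=> *; exists e'.
have [/prefixP[h bE]|ncb] := boolP (prefix c b).
  rewrite {}bE in iC npf reduce *.
  by have [e' []] := key _ _ iC npf; exact: reduce.
have [/prefixP[h cE]|nbc] := boolP (prefix b c); last first.
  (* Here [b] and [c] are incomparable, so no filter containing [(c, D0, c)] contains [f], and
     [None] is a vacuous exclusion. *)
  apply: (reduce None) => // q Fq Fq' Mq qA _ qC.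
  have [g [k [_ [E _ _ _]]]] := filter_dir Fq (qA0 _ Fq Fq' Mq qA) qC.
  by move: (cat_eq_prefix E); rewrite (negbTE ncb) (negbTE nbc).
set C' := (D0 `&` theta_word G h C)%O.
have qC' q : is_filter G q.1.1 -> is_filter G q.2 -> matched G mu nu q ->
    q.2 (idem (nu ++ g0) A0) -> q.1.1 (idem b C) -> q.1.1 (mk_triple c C' c).
  move=> Fq Fq' Mq qA qC; rewrite cE; apply: filter_meet qC _ (lexx D0) => //.
  by rewrite -cE; exact: qA0.
have iC' : ideal_word G (c ++ [::]) C'.
  by rewrite cats0; apply: ideal_word_le (filter_ideal F pD0) _; exact: leIl.
have [|e' [Ee' npe' nq]] := key _ _ iC'.
  rewrite cats0 cE => pC'; apply: npf; apply: filter_up pC' _ (leIr _ _) => //.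
apply: (reduce e') => // q Fq Fq' Mq qA nqe qC; apply: (nq q) => //.
by rewrite cats0; apply: filter_mk => //; exact: qC'.
Qed.

(** One neighbourhood of [p.2] handles [e] and one more each member of [es]; [V_set_meet] intersects
    them. *)
Lemma matched_nbhd mu nu p e es : tight G p.1.1 -> tight G p.2 ->
  matched G mu nu p -> (forall f, f \in es -> in_E G f) ->
  V_set G e es p.1.1 ->
  exists e' es', [/\ in_E G e', forall f, f \in es' -> in_E G f,
    V_set G e' es' p.2
    & forall q, tight G q.1.1 -> tight G q.2 -> matched G mu nu q ->
      V_set G e' es' q.2 -> V_set G e es q.1.1].
Proof.
move=> T T' M; have [[F _] [F' _]] := (T, T').
elim: es => [_ [_ pe _]|f es IH Ees [_ pe pes]].
  have [e' pe' qe] := matched_nbhd_pos F F' M pe.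
  exists e', [::]; split=> //; first by have [[sub _] _ _ _] := F'; exact: sub.
  move=> q Tq Tq' Mq [_ qe' _]; split=> //.
  by apply: (qe q) => //; [case: Tq|case: Tq'].
have [||e1 [es1 [Ee1 Ees1 V1 q1]]] := IH.
- by move=> h hes; apply: Ees; rewrite in_cons hes orbT.
- by split=> // h hes; apply: pes; rewrite in_cons hes orbT.
have Ef : in_E G f by apply: Ees; rewrite mem_head.
have [|e2 [f2 [pe2 Ef2 pf2 q2]]] := matched_nbhd_neg F F' M Ef.
  by apply: pes; rewrite mem_head.
have V2 : V_set G e2 [:: f2] p.2.
  by split=> // h; rewrite inE => /eqP ->.
have [e3 [Ee3 V3 sub3]] := V_set_meet V1 V2.
exists e3, (es1 ++ [:: f2]); split=> //.
  by move=> h; rewrite mem_cat inE => /orP[/Ees1|/eqP ->].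
move=> q Tq Tq' Mq /sub3[/(q1 _ Tq Tq' Mq)[_ qe qes] [_ qe2 qf2]].
split=> // h; rewrite in_cons => /orP[/eqP ->|]; last exact: qes.
by apply: (q2 q) => //; [case: Tq|case: Tq'|apply: qf2; rewrite mem_head].
Qed.

(** * Comparison of the two families of basic sets *)

(** Provides the middle entry that [Z_family] asks for. A nonzero [A] in the ideals of both
    [mu ++ g] and [nu ++ g] lies below the image of an element in one ideal, and interpolation moves
    that element into the other. An empty [nu] is treated apart because of [ideal_word_factor]. *)
Lemma matched_in_S mu nu p : is_filter G p.1.1 -> is_filter G p.2 ->
  matched G mu nu p -> exists A, in_S G (Some (mu, A, nu)).
Proof.
move=> F F' /(matchedP _ _ F F')[[g [D pD]] _ _ e].
have iD := filter_ideal F pD.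
have := mem_shift F pD; rewrite e => /shiftP[_ [A pA leA]].
have A0 := filter_neq0 F' pA; have iA := filter_ideal F' pA.
have iA' := ideal_word_le iD leA.
have [nu0|nu0] := eqVneq nu [::].
  have [mu0|mu0] := eqVneq mu [::]; first by exists A; rewrite mu0 nu0.
  have [C iC leC] := ideal_word_factor mu0 iA'.
  by exists C; rewrite nu0; split=> //; exact: theta_word_neq0 leC.
have [C iC leC] := ideal_word_factor nu0 iA.
have [C' [iC' leC' leA']] := ideal_word_interp iA' leC.
exists C'; split=> //; first exact: theta_word_neq0 leA'.
exact: ideal_word_le iC leC'.
Qed.

Lemma opens_of_basis_mem T (Bs : set (set T)) U : Bs U -> opens_of_basis Bs U.
Proof.
move=> BU; exists [set U]; first by move=> _ ->.
by rewrite bigcup_set1.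
Qed.

Lemma dom_sigma_starts n xi : dom_sigma G n xi ->
  exists2 a, size a = n & starts a xi.
Proof.
move=> [[F _] len].
have sn : size (wtake n (assoc_word xi)) = n.
  by case: (assoc_word xi) len => [s /size_takel|f _] //=; rewrite size_mkseq.
exists (wtake n (assoc_word xi)) => //; apply/starts_begins => //.
by rewrite /begins sn.
Qed.

Lemma open_injective_V_set mu g A e es : in_E G e ->
  (forall f, f \in es -> in_E G f) ->
  V_set G e es `<=` [set xi | xi (idem (mu ++ g) A)] ->
  open_injective G (size mu) (V_set G e es).
Proof.
move=> Ee Ees sub.
have S xi : V_set G e es xi -> starts mu xi by move=> /sub; exists g, A.
split.
- by apply: opens_of_basis_mem; exists e, es.
- move=> xi Vxi; have [T _ _] := Vxi; split=> //.
  by have [F _] := T; have /(starts_begins _ F)[] := S _ Vxi.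
- move=> xi eta; rewrite !inE => Vxi Veta.
  have [[F _] _ _] := Vxi; have [[F' _] _ _] := Veta.
  rewrite !iter_sigma //; try exact: S.
  by apply: shift_inj => //; exact: S.
Qed.

Lemma Z_refines_VX U p : Z_family G U -> U p ->
  exists2 W, VX_family G W & W p /\ W `<=` U.
Proof.
move=> [mu [_ [nu [e [es [_ Ee Ees ->]]]]]] [[T T' _] V M].
have [[F _] [F' _]] := (T, T').
have [[g [A pA]] [h [C pC]] k es'] := (matchedP _ _ F F').1 M.
have V0 : V_set G (idem (mu ++ g) A) [::] p.1.1 by [].
have V1 : V_set G (idem (nu ++ h) C) [::] p.2 by [].
(* The set of [V] alone does not force words to begin with [nu]; the intersection with that of [V1]
   does, which yields injectivity. *)
have [e' [Ee' V' sub]] := V_set_meet V V1; rewrite cats0 in V' sub.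
have EA : in_E G (idem (mu ++ g) A) by have [[subF _] _ _ _] := F; exact: subF.
have OX : open_injective G (size mu) (V_set G (idem (mu ++ g) A) [::]).
  by apply: (@open_injective_V_set _ g A) => // xi [].
have OY : open_injective G (size nu) (V_set G e' es).
  by apply: (@open_injective_V_set _ h C) => // xi /sub[_ []].
exists (VX_set G (V_set G (idem (mu ++ g) A) [::]) (size mu) (size nu)
  (V_set G e' es)); first by eexists _, _, _, _; split; [exact: OX|exact: OY|].
have [Sm Sn _ _] := (matchedP _ _ F F').1 M.
split; first by split=> //; rewrite !iter_sigma.
move=> q [Vq Vq' kq]; have [Tq qA _] := Vq; have [Ve [Tq' qC _]] := sub _ Vq'.
have [[Fq _] [Fq' _]] := (Tq, Tq').
have Sq : starts mu q.1.1 by exists g, A.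
have Sq' : starts nu q.2 by exists h, C.
rewrite !iter_sigma // => eq; have Mq : matched G mu nu q by apply/matchedP.
by split=> //; split=> //; exists mu, nu.
Qed.

Lemma VX_refines_Z U p : VX_family G U -> U p ->
  exists2 W, Z_family G W & W p /\ W `<=` U.
Proof.
move=> [X [m [n [Y [[OX dX _] [OY dY _] ->]]]]] [Xp Yp k e].
have [T _] := dX _ Xp; have [T' _] := dY _ Yp.
have [[F _] [F' _]] := (T, T').
have [mu sm Sm] := dom_sigma_starts (dX _ Xp).
have [nu sn Sn] := dom_sigma_starts (dY _ Yp).
rewrite -sm -sn !iter_sigma // in k e.
have M : matched G mu nu p by apply/matchedP.
have [FX subX EX] := OX; rewrite EX in Xp.
have [FY subY EY] := OY; rewrite EY in Yp.
have [VX FVX Vp] := Xp; have [VY FVY Vp'] := Yp.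
have [e1 [es1 [Ee1 Ees1 DX]]] := subX _ FVX; rewrite DX in Vp.
have [e2 [es2 [Ee2 Ees2 DY]]] := subY _ FVY; rewrite DY in Vp'.
(* Besides matching, a set of [Z_family] constrains only the second filter, so the condition on the
   first is turned into one on the second. *)
have [e3 [es3 [Ee3 Ees3 V3 q3]]] := matched_nbhd T T' M Ees1 Vp.
have [e4 [Ee4 V4 sub4]] := V_set_meet V3 Vp'.
have [A SA] := matched_in_S F F' M.
exists (Z_set G mu nu e4 (es3 ++ es2)).
  exists mu, A, nu, e4, (es3 ++ es2); split=> // f.
  by rewrite mem_cat => /orP[/Ees3|/Ees2].
split; first by split=> //; split=> //; exists mu, nu.
move=> q [[Tq Tq' _] /sub4[Vq Vq'] Mq]; have [[Fq _] [Fq' _]] := (Tq, Tq').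
have [Sq Sq' kq eq] := (matchedP _ _ Fq Fq').1 Mq.
split.
- by rewrite EX; exists VX => //; rewrite DX; exact: q3.
- by rewrite EY; exists VY => //; rewrite DY.
- by rewrite kq sm sn.
- by rewrite -sm -sn !iter_sigma.
Qed.

(** * Basis axioms for [Z_family] *)

Lemma Z_sub_Gamma U : Z_family G U -> U `<=` Gamma G.
Proof. by move=> [mu [A [nu [e [es [_ _ _ ->]]]]]] p []. Qed.

Lemma Z_cover p : Gamma G p -> exists2 U, Z_family G U & U p.
Proof.
move=> Gp; have [T T' [mu [nu M]]] := Gp; have [[F _] [F' _]] := (T, T').
have [A SA] := matched_in_S F F' M.
have [[sub [e pe]] _ _ _] := F'.
exists (Z_set G mu nu e [::]); last by split.
by exists mu, A, nu, e, [::]; split=> //; exact: sub.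
Qed.

(** At a common point one pair of words extends the other by a common suffix. The longer pair is
    kept, and [matched_catl] recovers the shorter. *)
Lemma Z_meet U V p : Z_family G U -> Z_family G V -> U p -> V p ->
  exists2 W, Z_family G W & W p /\ W `<=` U `&` V.
Proof.
move=> [mu [A [nu [e [es [SA Ee Ees ->]]]]]].
move=> [mu' [A' [nu' [e' [es' [SA' Ee' Ees' ->]]]]]].
move=> [Gp Vp M] [_ Vp' M']; have [[F _] [F' _] _] := Gp.
have [e3 [Ee3 V3 sub3]] := V_set_meet Vp Vp'.
have E3 f : f \in es ++ es' -> in_E G f.
  by rewrite mem_cat => /orP[/Ees|/Ees'].
have [le|/ltnW le] := leqP (size mu) (size mu').
  have [g mE nE] := matched_comparable F F' M M' le.
  exists (Z_set G mu' nu' e3 (es ++ es')).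
    by exists mu', A', nu', e3, (es ++ es').
  split=> // q [Gq /sub3[Vq Vq'] Mq]; split=> //; split=> //.
  have [[Fq _] [Fq' _] _] := Gq.
  by rewrite mE nE in Mq; exact: matched_catl Mq.
have [g mE nE] := matched_comparable F F' M' M le.
exists (Z_set G mu nu e3 (es ++ es')).
  by exists mu, A, nu, e3, (es ++ es').
split=> // q [Gq /sub3[Vq Vq'] Mq]; split=> //; split=> //.
have [[Fq _] [Fq' _] _] := Gq.
by rewrite mE nE in Mq; exact: matched_catl Mq.
Qed.

End Systems.

(** * Families of sets that refine each other *)

Lemma opens_of_basis_refines T (B1 B2 : set (set T)) :
  (forall U x, B1 U -> U x -> exists2 V, B2 V & V x /\ V `<=` U) ->
  opens_of_basis B1 `<=` opens_of_basis B2.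
Proof.
move=> ref _ [F FB ->].
exists [set V | B2 V /\ V `<=` \bigcup_(A in F) A]; first by move=> V [].
apply/seteqP; split=> [x [U FU Ux]|x [V [_ sub] Vx]]; last exact: sub.
have [V BV [Vx sub]] := ref _ _ (FB _ FU) Ux.
by exists V => //; split=> // y /sub; exists U.
Qed.

(** Lets the basis axioms for [VX_family] follow from those for [Z_family]. *)
Lemma is_basis_on_refines T (X : set T) (B1 B2 : set (set T)) :
  (forall U x, B1 U -> U x -> exists2 V, B2 V & V x /\ V `<=` U) ->
  (forall U x, B2 U -> U x -> exists2 V, B1 V & V x /\ V `<=` U) ->
  is_basis_on X B1 -> is_basis_on X B2.
Proof.
move=> ref12 ref21 [sub cov meet]; split.
- move=> U BU x Ux; have [V BV [Vx _]] := ref21 _ _ BU Ux.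
  exact: sub BV _ Vx.
- move=> x /cov[U BU Ux]; have [V BV [Vx _]] := ref12 _ _ BU Ux.
  by exists V.
move=> U V x BU BV Ux Vx.
have [U' BU' [Ux' subU]] := ref21 _ _ BU Ux.
have [V' BV' [Vx' subV]] := ref21 _ _ BV Vx.
have [W BW [Wx subW]] := meet _ _ _ BU' BV' Ux' Vx'.
have [W' BW' [Wx' subW']] := ref12 _ _ BW Wx.
exists W' => //; split=> // y /subW'/subW[Uy Vy].
by split; [exact: subU|exact: subV].
Qed.

Unset Implicit Arguments.

Theorem proposition5p13 (d : Order.disp_t) (B : cbDistrLatticeType d)
    (L : eqType) (G : gbds B L) :
  [/\ is_basis_on (Gamma G) (Z_family G),
      is_basis_on (Gamma G) (VX_family G)
    & opens_of_basis (Z_family G) = opens_of_basis (VX_family G)].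
Proof.
have refZ := @Z_refines_VX _ B L G; have refVX := @VX_refines_Z _ B L G.
have basisZ : is_basis_on (Gamma G) (Z_family G).
  split; [exact: Z_sub_Gamma|by move=> p /Z_cover[U]; exists U|].
  by move=> U V p BU BV; exact: Z_meet.
split=> //; first exact: is_basis_on_refines basisZ.
by apply/seteqP; split; exact: opens_of_basis_refines.
Qed.
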